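(* Let $I$ be a compact interval, and assume that $f : I \to I$ is a continuous map. If $f$ has a period-$m$ point, then $f$ also has a period-$n$ point precisely when $m \prec n$ in Sharkovsky's ordering.
   Context: For a map $f : I \to I$ and an integer $n \ge 1$, $f^n$ is defined by $f^1 = f$ and $f^n = f \circ f^{n-1}$ when $n \ge 2$. A point $y \in I$ is a periodic point of $f$ with least period $m$ (a period-$m$ point of $f$) if $f^m(y) = y$ and $f^i(y) \ne y$ when $0 < i < m$. Sharkovsky's ordering of the positive integers is $$3 \prec 5 \prec 7 \prec \cdots \prec 2 \cdot 3 \prec 2 \cdot 5 \prec 2 \cdot 7 \prec \cdots \prec 2^2 \cdot 3 \prec 2^2 \cdot 5 \prec 2^2 \cdot 7 \prec \cdots \prec 2^3 \prec 2^2 \prec 2 \prec 1.$$ *)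

(* Defs.v *)
From mathcomp Require Import all_boot all_order all_algebra.
From mathcomp Require Import all_classical all_reals all_analysis.

Set Implicit Arguments.
Unset Strict Implicit.
Unset Printing Implicit Defensive.

Local Open Scope classical_set_scope.
Local Open Scope nat_scope.

Definition periodic_point (T : Type) (f : T -> T) (m : nat) (y : T) : Prop :=
  [/\ 0 < m, iter m f y = y & forall i, 0 < i < m -> iter i f y <> y].

Definition has_period (T : Type) (I : set T) (f : T -> T) (m : nat) : Prop :=
  exists2 y, I y & periodic_point f m y.

(* The strict ordering
     3, 5, 7, ..., 2*3, 2*5, 2*7, ..., 2^2*3, 2^2*5, 2^2*7, ...,
     ..., 2^3, 2^2, 2, 1;
   only positive integers are related. *)
Inductive sharkovsky_lt : nat -> nat -> Prop :=
| sharkovsky_same_row k p q :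
    odd p -> odd q -> 1 < p -> p < q ->
    sharkovsky_lt (2 ^ k * p) (2 ^ k * q)
| sharkovsky_later_row k l p q :
    odd p -> odd q -> 1 < p -> 1 < q -> k < l ->
    sharkovsky_lt (2 ^ k * p) (2 ^ l * q)
| sharkovsky_row_power k l p :
    odd p -> 1 < p -> sharkovsky_lt (2 ^ k * p) (2 ^ l)
| sharkovsky_powers k l :
    l < k -> sharkovsky_lt (2 ^ k) (2 ^ l).

(* Main.v *)
Require Import Defs.
From mathcomp Require Import all_boot all_order all_algebra.
From mathcomp Require Import all_classical all_reals all_analysis.
From mathcomp Require Import ring lra zify.
Import numFieldNormedType.Exports.
Import Order.TTheory GRing.Theory Num.Theory.

Set Implicit Arguments.
Unset Strict Implicit.
Unset Printing Implicit Defensive.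

Local Open Scope classical_set_scope.
Local Open Scope ring_scope.

(** Forcing. Let p be the leftmost point of a cycle of length m > 2 and b the
point of the cycle sent to p. Some point of the cycle to the left of b is not
moved to the left of b, so there is v < b with f(v) = b, hence f(f(v)) = p, and
a fixed point z between v and b. The last fixed point y of f^2 before v
satisfies f(y) > z, so it has period 2 ([turning_points],
[period_2_of_gt2]). If m is odd, then
f^(m+2) crosses the diagonal between y and v, and the leftmost crossing has
period exactly m+2 ([odd_period_next]). Still for m odd, f^2 folds an interval
]d, z0[ around v over itself twice (a horseshoe) while f sends ]d, z0[ to the
right of z; periodic points of f^2 inside ]d, z0[ with every least period n
exist ([horseshoe_cycle]), and they have period 2n for f ([odd_period_even]).
Applying these facts to the iterates f^(2^k), and computing how least periods
for f^(2^k) and for f are related ([periodic_iter_pow2]), gives every relation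
of the order ([sharkovsky_forcing]). The argument takes place on the real
line; a self-map of [a, b] is extended by first clamping its argument to [a, b].

Sharpness. The tent map on [0, 1] has a point of period 3, hence of every
period. For each m let h(m) be the least possible value of the rightmost point
of a cycle of length m of the tent map; the minimum exists because a point with
T^m(x) = x is an integer multiple of 1/(4^m - 1) ([least_cycle_top]). The map
min(h(m), T) has the m-cycle through h(m), and all its cycles of another length
n lie strictly below h(m), so they are cycles of T and h(n) < h(m). In
particular, by the forcing part, m preceding n implies h(n) < h(m). Since the
order is total ([sharkovsky_total]), if m does not precede n then n precedes m,
so h(m) < h(n) and min(h(m), T) has period m but not n
([truncated_tent_realizes]). *)

(** * Least periods of a map and of its iterates *)

Lemma iter_mod (T : Type) (f : T -> T) m x : iter m f x = x ->
  forall j, iter j f x = iter (j %% m) f x.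
Proof.
move=> fx j; rewrite {1}(divn_eq j m) addnC iterD; congr (iter _ f _).
by elim: (j %/ m)%N => //= k IH; rewrite mulSn iterD IH.
Qed.

Lemma iter_dvdn (T : Type) (f : T -> T) m x j : iter m f x = x ->
  (m %| j)%N -> iter j f x = x.
Proof. by move=> fx /eqP j0; rewrite (iter_mod fx) j0. Qed.

Lemma periodic_iterE (T : Type) (f : T -> T) m x j : periodic_point f m x ->
  iter j f x = x <-> (m %| j)%N.
Proof.
move=> [m0 fx nx]; split; last exact: iter_dvdn.
rewrite (iter_mod fx) /dvdn.
have := ltn_pmod j m0; case: (posnP (j %% m)) => [//|j0 jm] /(nx _).
by rewrite j0 jm => /(_ isT).
Qed.

Lemma periodic_unique (T : Type) (f : T -> T) m n x :
  periodic_point f m x -> periodic_point f n x -> m = n.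
Proof.
move=> pm pn; have [_ fm _] := pm; have [_ fn _] := pn.
apply/eqP; rewrite eqn_dvd.
by move/(periodic_iterE _ pm): fn => ->; move/(periodic_iterE _ pn): fm.
Qed.

Lemma periodic_exists (T : Type) (f : T -> T) n x :
  (0 < n)%N -> iter n f x = x -> exists m, periodic_point f m x.
Proof.
move=> n0 fx.
have ex : exists k, (fun k => `[< (0 < k)%N /\ iter k f x = x >]) k.
  by exists n; apply/asboolP.
case: (ex_minnP ex) => m /asboolP [m0 fm] mP.
exists m; split => // i /andP[i0 im] fi.
by move: im; rewrite ltnNge mP //; apply/asboolP.
Qed.

Lemma periodic_orbit (T : Type) (f : T -> T) m x k :
  periodic_point f m x -> periodic_point f m (iter k f x).
Proof.
move=> pm; have [m0 fx nx] := pm; split=> //.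
  by rewrite -iterD addnC iterD fx.
move=> i /andP[i0 im] /(congr1 (iter (k * m.-1) f)).
have km : (k * m.-1 + k = k * m)%N by rewrite addnC -mulnS prednK.
rewrite -!iterD addnAC km addnC iterD (iter_dvdn fx) ?dvdn_mull //.
by apply: nx; rewrite i0.
Qed.

Lemma periodic_iter_mul (T : Type) (f : T -> T) d m x : (0 < m)%N ->
  periodic_point f (d * m) x -> periodic_point (iter d f) m x.
Proof.
move=> m0 [dm0 fx nx]; split=> //; first by rewrite -iterM mulnC.
move=> i /andP[i0 im]; rewrite -iterM; apply: nx.
move: dm0; rewrite muln_gt0 => /andP[d0 _].
by rewrite muln_gt0 i0 d0 mulnC ltn_pmul2l.
Qed.

Lemma odd_decomp n : (0 < n)%N -> exists k p, odd p /\ n = (2 ^ k * p)%N.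
Proof.
move=> n0; have [p] := pfactor_coprime (isT : prime 2) n0.
rewrite coprime2n => op ->; exists (logn 2 n), p.
by rewrite mulnC.
Qed.

(** Write the least period of x under f as p = 2^i q with q odd. Either
divisibility, of 2^k j by p or of j by n, says that f^(2^k j) fixes x. If i <= k
this forces n = q, and if i > k it forces n = p / 2^k. *)
Lemma periodic_iter_pow2 (T : Type) (f : T -> T) k n x :
  periodic_point (iter (2 ^ k) f) n x ->
  exists i, [/\ (i <= k)%N, i = k \/ odd n & periodic_point f (2 ^ i * n) x].
Proof.
move=> pn; have [n0 fx nx] := pn.
have nk : (0 < n * 2 ^ k)%N by rewrite muln_gt0 n0 expn_gt0.
move: fx; rewrite -iterM => fx.
have [p pp] := periodic_exists nk fx.
have [p0 fp _] := pp.
have pE j : (p %| j * 2 ^ k)%N = (n %| j)%N.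
  by apply/idP/idP => /=;
    [move/(periodic_iterE _ pp) | move=> nj; apply/(periodic_iterE _ pp)];
    rewrite ?iterM; [move/(periodic_iterE _ pn) | apply/(periodic_iterE _ pn)].
have [i [q [oq pq]]] := odd_decomp p0.
have [ik|ki] := leqP i k.
  have qn : q = n.
    apply/eqP; rewrite eqn_dvd -[X in _ && X]pE pq [(q * _)%N]mulnC.
    rewrite dvdn_mul ?dvdn_exp2l //.
    have : (p %| n * 2 ^ k)%N by rewrite pE.
    rewrite pq => /(dvdn_trans (dvdn_mull _ (dvdnn q))).
    by rewrite mulnC Gauss_dvdr ?coprimeXr ?coprimen2 // andbT.
  by exists i; split=> //; [right; rewrite -qn | rewrite -qn -pq].
exists k; split=> //; first by left.
set r := (2 ^ (i - k) * q)%N.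
have pr : p = (2 ^ k * r)%N by rewrite /r mulnA -expnD subnKC // ltnW.
suff -> : n = r by rewrite -pr.
apply/eqP; rewrite eqn_dvd -pE pr [(r * _)%N]mulnC dvdnn /=.
by have := pE n; rewrite pr dvdnn mulnC dvdn_pmul2r ?expn_gt0.
Qed.

(** The real-valued phi serves both for minima (phi = id) and maxima
(phi = - id) of cycles. *)
Lemma orbit_min (R : realType) (T : Type) (phi : T -> R) (f : T -> T) m x :
  (0 < m)%N -> iter m f x = x ->
  exists k, forall j, phi (iter k f x) <= phi (iter j f x).
Proof.
move=> m0 fx.
have [k _ kP] := @arg_minP _ R _ (Ordinal m0) xpredT
  (fun i : 'I_m => phi (iter i f x)) isT.
exists k => j; rewrite (iter_mod fx j).
exact: (kP (Ordinal (ltn_pmod j m0))).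
Qed.

(** * Zeros of continuous functions *)

Lemma root_between (R : realType) (h : R -> R) p q : continuous h -> p <= q ->
  0 <= h p -> h q <= 0 -> exists c, [/\ p <= c, c <= q & h c = 0].
Proof.
move=> ch pq hp hq.
have [|c] := @IVT R h p q 0 pq (continuous_subspaceT ch).
  by rewrite ge_min le_max hp hq orbT.
by rewrite in_itv /= => /andP[pc cq] hc; exists c.
Qed.

Lemma pos_of_root_free (R : realType) (h : R -> R) p q x0 : continuous h ->
  p <= x0 <= q -> 0 < h x0 -> (forall x, p <= x <= q -> h x <> 0) ->
  forall x, p <= x <= q -> 0 < h x.
Proof.
move=> ch /andP[px xq] hx0 h0 x /andP[px' xq']; rewrite ltNge; apply/negP => hx.
have [|] := leP x0 x => xx.
  have [c [? ? hc]] := root_between ch xx (ltW hx0) hx.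
  by apply: (h0 c) hc; lra.
have [|||c [? ? hc]] := @root_between _ (fun y => - h y) _ _ _ (ltW xx).
- by move=> y; apply: continuousN; exact: ch.
- by rewrite oppr_ge0.
- by rewrite oppr_le0 ltW.
by apply: (h0 c); lra.
Qed.

(** The first zero is the minimum of the compact set where h <= 0 on [p, q]. *)
Lemma first_root (R : realType) (h : R -> R) p q : continuous h -> p <= q ->
  0 < h p -> h q <= 0 ->
  exists c, [/\ p < c, c <= q, h c = 0 & forall x, p <= x < c -> 0 < h x].
Proof.
move=> ch pq hp hq.
pose A := `[p, q] `&` [set x | h x <= 0].
have cA : compact A.
  apply: (@subclosed_compact _ _ `[p, q]);
    [|exact: segment_compact|exact: subIsetl].
  apply: closedI; first exact: interval_closed.
  by have /continuous_closedP/(_ _ (@closed_le R 0)) := ch.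
have A0 : A !=set0 by exists q; split => //=; rewrite in_itv /= pq lexx.
have [|c] := @compact_EVT_min R R id A A0 cA.
  by apply: continuous_subspaceT => x; exact: cvg_id.
move=> /set_mem [/=]; rewrite in_itv /= => /andP[pc cq] hc cP.
have hpos x : p <= x < c -> 0 < h x.
  move=> /andP[px xc]; rewrite ltNge; apply/negP => hx.
  suff : c <= x by lra.
  apply: cP; apply/mem_set; split=> //=; rewrite in_itv /=; lra.
have pc' : p < c.
  by rewrite lt_neqAle pc andbT; apply/eqP => E; move: hc; rewrite -E; lra.
exists c; split=> //.
have [c' [pc'' cc' hc']] := root_between ch pc (ltW hp) hc.
have [<-//|cc] := eqVneq c' c.
have := hpos c'; rewrite hc' ltxx pc'' lt_neqAle cc cc' => /(_ isT); by [].
Qed.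

Lemma last_root (R : realType) (h : R -> R) p q : continuous h -> p <= q ->
  0 <= h p -> h q < 0 ->
  exists c, [/\ p <= c, c < q, h c = 0 & forall x, c < x <= q -> h x < 0].
Proof.
move=> ch pq hp hq.
have [||||c [? ? hc cP]] := @first_root _ (fun x => - h (- x)) (- q) (- p).
- move=> x; apply: continuousN; apply: continuous_comp.
    exact: opp_continuous.
  exact: ch.
- lra.
- by rewrite opprK oppr_gt0.
- by rewrite opprK oppr_le0.
exists (- c); split; [lra | lra | lra|] => x /andP[cx xq].
by have := cP (- x); rewrite opprK; lra.
Qed.

Lemma continuous_iter (R : realType) (f : R -> R) n :
  continuous f -> continuous (iter n f).
Proof.
move=> cf; elim: n => [|n IH] x; first exact: cvg_id.
by apply: (@continuous_comp _ _ _ (iter n f) f); [exact: IH | exact: cf].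
Qed.

Lemma continuous_subid (R : realType) (f : R -> R) : continuous f ->
  continuous (fun x => f x - x).
Proof. by move=> cf x; apply: continuousB; [exact: cf | exact: cvg_id]. Qed.

Lemma continuous_subc (R : realType) (f : R -> R) (c : R) : continuous f ->
  continuous (fun x => f x - c).
Proof.
move=> cf x; apply: (@continuousB _ _ _ f (fun=> c)); first exact: cf.
exact: cvg_cst.
Qed.

(** * Cycles of a continuous map of the line *)

(** Here v is sent to the point b = f^(m-1)(p) of the cycle, b to the minimum p,
y is the last fixed point of f^2 before v and z is a fixed point between v and
b. To the right of y, up to v, f^2 lies below the diagonal; f stays above z
there, because f(x) = z would give f(f(x)) = z > x. *)
Lemma turning_points (R : realType) (f : R -> R) m p :
    continuous f -> (2 < m)%N -> periodic_point f m p ->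
    (forall j, p <= iter j f p) ->
  exists y v z, [/\ p <= y, y < v, v < z & z < iter m.-1 f p] /\
   [/\ f (f v) = p, f (f y) = y, f z = z,
       forall x, y < x <= v -> f (f x) < x & forall x, y <= x <= v -> z < f x].
Proof.
move=> cf m2 pm pmin; have [m0 fp np] := pm.
set b := iter m.-1 f p.
have fb : f b = p by rewrite /b -iterS prednK.
have pb : p < b.
  rewrite lt_neqAle pmin andbT; apply/eqP => /esym; apply: np.
  by apply/andP; split; lia.
have cff : continuous (fun x => f (f x)) by exact: (@continuous_iter R f 2).
(* Otherwise the orbit of p would stay to the left of b and never reach b. *)
have [x [px xb bx]] : exists x, [/\ p <= x, x < b & b <= f x].
  apply: contrapT => nx.
  have: forall j, iter j f p < b.
    elim=> [//|j IH] /=; rewrite ltNge; apply/negP => bf; apply: nx.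
    by exists (iter j f p).
  by move/(_ m.-1); rewrite ltxx.
have [|||v [xv vb fv]] := @root_between R (fun t => f t - b) x b _ (ltW xb).
- exact: continuous_subc.
- by rewrite subr_ge0.
- by rewrite fb subr_le0 ltW.
move/subr0_eq: fv => fv.
have {}vb : v < b.
  by rewrite lt_neqAle vb andbT; apply/eqP => E; move: fv; rewrite E fb; lra.
have pv : p < v.
  rewrite lt_neqAle (le_trans px xv) andbT; apply/eqP => E.
  by apply: (np 2%N) => //=; rewrite E fv fb -E.
have [|||z [vz zb fz]] := @root_between R (fun t => f t - t) v b _ (ltW vb).
- exact: continuous_subid.
- by rewrite fv; lra.
- by rewrite fb; lra.
move/subr0_eq: fz => fz.
have {}vz : v < z.
  by rewrite lt_neqAle vz andbT; apply/eqP => E; move: fz; rewrite -E fv; lra.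
have {}zb : z < b.
  by rewrite lt_neqAle zb andbT; apply/eqP => E; move: fz; rewrite E fb; lra.
have [|||y [py yv ffy yP]] :=
  @last_root R (fun t => f (f t) - t) p v _ (ltW pv).
- exact: (continuous_subid cff).
- by rewrite subr_ge0; exact: (pmin 2%N).
- by rewrite fv fb; lra.
move/subr0_eq: ffy => ffy.
exists y, v, z; split=> //; split=> //; first by rewrite fv.
  by move=> t /yP; rewrite subr_lt0.
move=> t ty; rewrite -subr_gt0.
apply: (@pos_of_root_free R (fun t => f t - z) y v v) ty => //=.
- exact: continuous_subc.
- by rewrite lexx ltW.
- by rewrite fv subr_gt0.
move=> s ys /subr0_eq fs; have [E|sy] := eqVneq s y.
  by move: ffy; rewrite -E fs fz; lra.
have := yP s; rewrite fs fz; move: sy; rewrite eq_sym => sy.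
rewrite lt_neqAle sy => /(_ ys); lra.
Qed.

Lemma min_periodic_point (R : realType) (f : R -> R) m x :
  periodic_point f m x ->
  exists2 p, periodic_point f m p & forall j, p <= iter j f p.
Proof.
move=> pm; have [m0 fx _] := pm.
have [k kP] := orbit_min id m0 fx.
exists (iter k f x); first exact: periodic_orbit.
by move=> j; rewrite -iterD; exact: kP.
Qed.

Lemma period_2_of_gt2 (R : realType) (f : R -> R) m x :
  continuous f -> (2 < m)%N -> periodic_point f m x ->
  exists y, periodic_point f 2 y.
Proof.
move=> cf m2 /min_periodic_point[p pm pmin].
have [y [v [z [[py yv vz zb] [ffv ffy fz _ zP]]]]] :=
  turning_points cf m2 pm pmin.
exists y; split=> // -[|[|i]] // _ /= fy.
by have := zP y; rewrite fy lexx (ltW yv) => /(_ isT); lra.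
Qed.

(** f(x) - x is nonnegative at the leftmost point of the cycle and nonpositive
at its rightmost one. *)
Lemma fixed_point_of_period (R : realType) (f : R -> R) m x : continuous f ->
  periodic_point f m x -> exists y, periodic_point f 1 y.
Proof.
move=> cf /min_periodic_point[p [m0 fp _] pmin].
have [k kP] := orbit_min (fun t : R => - t) m0 fp.
have [|||z [_ _ fz]] :=
  @root_between R (fun t => f t - t) p (iter k f p) _ (pmin k).
- exact: continuous_subid.
- by rewrite subr_ge0; exact: (pmin 1%N).
- by rewrite subr_le0 -lerN2; exact: (kP k.+1).
exists z; split=> //; first by move/subr0_eq: fz.
by case=> [|i].
Qed.

(** Since y has period 2, f^(m+2)(y) = f(y) > y, whereas f^(m+2)(v) = p < v; let
c be the leftmost fixed point of f^(m+2) between y and v. Its least period k is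
odd, and k > 1 as f(c) > z > c. If k were smaller than m+2, adding 2 to the
exponent repeatedly would move a solution of f^j(x) = x strictly to the left,
and for j = m+2 contradict the choice of c. *)
Lemma odd_period_next (R : realType) (f : R -> R) m x : continuous f -> odd m ->
  (1 < m)%N -> periodic_point f m x -> exists y, periodic_point f m.+2 y.
Proof.
move=> cf om m1 /min_periodic_point[p pm pmin].
have m2 : (2 < m)%N by case: m om m1 {pm} => [|[|[|]]].
have [y [v [z [[py yv vz zb] [ffv ffy fz yP zP]]]]] :=
  turning_points cf m2 pm pmin.
have citer j : continuous (fun t => iter j f t - t).
  exact: continuous_subid (continuous_iter cf).
have fodd j : odd j -> iter j f y = f y.
  move=> oj; rewrite -(odd_double_half j) oj add1n iterS -muln2 iterM.
  by congr f; elim: (j./2) => //= i ->.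
have zfy : z < f y by apply: zP; rewrite lexx ltW.
have om2 : odd m.+2 by rewrite /= negbK.
have [|||c [yc cv fc cP]] :=
  @first_root R (fun t => iter m.+2 f t - t) y v _ (ltW yv).
- exact: citer.
- by rewrite fodd //; lra.
- by rewrite subr_le0 -addn2 iterD /= ffv; have [_ -> _] := pm; lra.
move/subr0_eq: fc => fc.
have [k pk] := periodic_exists (isT : (0 < m.+2)%N) fc.
have [k0 fk nk] := pk.
have km : (k %| m.+2)%N by apply/(periodic_iterE _ pk).
have ok : odd k by apply: dvdn_odd km om2.
have zfc : z < f c by apply: zP; rewrite (ltW yc) cv.
have k1 : k <> 1%N by move=> E; move: fk; rewrite E /=; lra.
have [E|nE] := eqVneq k m.+2; first by exists c; rewrite -E.
have km2 : (k.+2 <= m.+2)%N.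
  have := dvdn_leq (isT : (0 < m.+2)%N) km; rewrite leq_eqVlt (negbTE nE) /=.
  rewrite ltnS leq_eqVlt => /orP[/eqP E|//].
  by move: ok; rewrite E /= om.
(* If f^(k+2n)(d) = d then f^(k+2n+2)(t) - t is positive at y and equals
   f(f(d)) - d < 0 at d, so it vanishes between them. *)
have desc n : exists d,
    [/\ y < d, d <= c, iter (k + n.*2) f d = d & (0 < n)%N -> d < c].
  elim: n => [|n [d [yd dc fd _]]]; first by exists c; rewrite addn0.
  have [|||e [ye ed fe _]] :=
    @first_root R (fun t => iter (k + n.+1.*2) f t - t) y d _ (ltW yd).
  - exact: citer.
  - by rewrite fodd ?oddD ?odd_double ?ok //; lra.
  - by rewrite subr_le0 doubleS !addnS !iterS fd; apply/ltW/yP; lra.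
  move/subr0_eq: fe => fe.
  exists e; split=> //; first by lra.
  move=> _; apply: (lt_le_trans _ dc).
  rewrite lt_neqAle ed andbT; apply/eqP => E.
  have: f (f d) < d by apply: yP; lra.
  by move: fe; rewrite E doubleS !addnS !iterS fd; lra.
have [d [yd _ fd dc]] := desc ((m.+2 - k)./2).
have hk : (k <= m.+2)%N by lia.
have en : ((m.+2 - k)./2.*2 = m.+2 - k)%N.
  by rewrite even_halfK // oddB // ok /= om.
have {}dc : d < c by apply: dc; rewrite -double_gt0 en; lia.
move: fd; rewrite en subnKC // => fd.
by have := cP d; rewrite fd (ltW yd) dc subrr ltxx => /(_ isT).
Qed.

(** The inequalities c < g^i(c) say directly that n is the least period of c.
They come from minimality: c_n, the first fixed point of g^n to the right of d,
decreases strictly with n. Indeed g^n maps [d, c_n] onto an interval containing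
u, so that g^(n+1) takes the value d inside [d, c_n] and has crossed the
diagonal before; hence g^i lies above the diagonal on [d, c_n] for i < n. *)
Lemma horseshoe_cycle (R : realType) (g : R -> R) d u e n :
    continuous g -> d < u -> u < e -> g d = e -> g e = e -> g u = d ->
  (0 < n)%N -> exists c, [/\ d < c, c <= u, iter n g c = c &
    forall i, (0 < i < n)%N -> c < iter i g c].
Proof.
move=> cg du ue gd ge gu.
have gnd j : (0 < j)%N -> iter j g d = e.
  by case: j => // j _; rewrite iterSr gd; elim: j => //= j ->.
have cgn j : continuous (iter j g) by exact: continuous_iter.
suff cN j : (0 < j)%N -> exists c, [/\ d < c, c <= u, iter j g c = c,
    forall i s, (0 < i <= j)%N -> d <= s < c -> s < iter i g s &
    forall i, (0 < i < j)%N -> c < iter i g c].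
  by move=> /cN[c [dc cu gc _ cL]]; exists c.
elim: j => // -[_ _|j IH _].
  have [|||c [dc cu gc cP]] := @first_root R (fun s => g s - s) d u _ (ltW du).
  - exact: continuous_subid.
  - by lra.
  - by lra.
  move/subr0_eq: gc => gc.
  exists c; split=> //; last by case=> [|[]].
  by case=> [|[|]] // s _ /cP /=; rewrite subr_gt0.
have [c [dc cu gc cP cL]] := IH isT.
have [|||w [dw wc gw]] :=
  @root_between R (fun s => iter j.+1 g s - u) d c _ (ltW dc).
- exact: continuous_subc.
- by rewrite gnd //; lra.
- by rewrite gc; lra.
move/subr0_eq: gw => gw.
have {}dw : d < w.
  rewrite lt_neqAle dw andbT; apply/eqP => E.
  by move: gw; rewrite -E gnd //; lra.
have [|||c' [dc' cw' gc' cP']] :=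
  @first_root R (fun s => iter j.+2 g s - s) d w _ (ltW dw).
- exact: continuous_subid.
- by rewrite gnd //; lra.
- by rewrite iterS gw; lra.
move/subr0_eq: gc' => gc'.
have cw : c' < w.
  rewrite lt_neqAle cw' andbT; apply/eqP => E.
  by move: gc'; rewrite E iterS gw; lra.
exists c'; split=> //; first by lra.
  move=> i s /andP[i0]; rewrite leq_eqVlt => /orP[/eqP -> /cP'|ij sc].
    by rewrite subr_gt0.
  by apply: cP; [rewrite i0 | lra].
by move=> i /andP[i0 ij]; apply: cP; [rewrite i0 | lra].
Qed.

(** Let z0 be the first fixed point of g = f^2 after v and d the last point
before y with g(d) = z0. On ]d, z0[ the map g stays below z0, so f cannot take
the value z there and, as f(v) > z, stays above z. Oddness of m gives the
existence of d: b is an iterate of p under g, so the orbit of p under g has to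
jump over z0. As g(v) = p <= d, there is u in ]d, v] with g(u) = d, and d, u, z0
form a horseshoe for g. The resulting point of period n for g has its g-orbit in
]d, z0[, so its odd iterates under f exceed z and differ from it. *)
Lemma odd_period_even (R : realType) (f : R -> R) m x n :
  continuous f -> odd m -> (1 < m)%N -> (0 < n)%N ->
  periodic_point f m x -> exists y, periodic_point f n.*2 y.
Proof.
move=> cf om m1 n0 /min_periodic_point[p pm pmin].
have m2 : (2 < m)%N by case: m om m1 {pm} => [|[|[|]]].
have [y [v [z [[py yv vz zb] [ffv ffy fz yP zP]]]]] :=
  turning_points cf m2 pm pmin.
pose g t := f (f t).
have gE j t : iter j g t = iter j.*2 f t by rewrite -muln2 iterM.
have cg : continuous g by exact: (@continuous_iter R f 2).
have [|||z0 [vz0 z0z gz0 z0P]] :=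
  @first_root R (fun t => t - g t) v z _ (ltW vz).
- by move=> t; apply: continuousB; [exact: cvg_id | exact: cg].
- by rewrite /g ffv; lra.
- by rewrite /g !fz; lra.
have {}gz0 : g z0 = z0 by lra.
have gdec t : y < t < z0 -> g t < t.
  move=> /andP[yt tz]; have [tv|vt] := leP t v; first by apply: yP; rewrite yt.
  by have := z0P t; lra.
have [t [pt ty gt]] : exists t, [/\ p <= t, t < y & z0 <= g t].
  apply: contrapT => nt.
  have : forall j, iter j g p < z0.
    elim=> [/=|j IH]; first lra.
    rewrite iterS ltNge; apply/negP => H; apply: nt; exists (iter j g p).
    have pj : p <= iter j g p by rewrite gE.
    split=> //; rewrite ltNge; apply/negP => yj.
    move: yj; rewrite le_eqVlt => /orP[/eqP E|yj].
      by move: H; rewrite -E /g ffy; lra.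
    by have := gdec (iter j g p); lra.
  move/(_ m./2); rewrite gE.
  have -> : (m./2.*2 = m.-1)%N by rewrite -[in RHS](odd_double_half m) om.
  lra.
have [|||d [td dy gd dP]] := @last_root R (fun s => g s - z0) t y _ (ltW ty).
- exact: continuous_subc.
- by rewrite subr_ge0.
- by rewrite /g ffy; lra.
move/subr0_eq: gd => gd.
have gz s : d < s < z0 -> g s < z0.
  move=> /andP[ds sz]; have [sy|ys] := leP s y; first by have := dP s; lra.
  by have := gdec s; lra.
have fgtz s : d < s < z0 -> z < f s.
  (* f - z has no zero on the interval spanned by s and v. *)
  move=> dsz; pose lo := Order.min s v; pose hi := Order.max s v.
  have lohi r : lo <= r <= hi -> d < r < z0.
    rewrite /lo /hi minEle maxEle; case: ifP => _; lra.
  rewrite -subr_gt0.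
  apply: (@pos_of_root_free R (fun r => f r - z) lo hi v) => //=.
  - exact: continuous_subc.
  - by rewrite ge_min le_max lexx !orbT.
  - by have := zP v; lra.
  - move=> r /lohi /gz + /subr0_eq fr; rewrite /g fr fz; lra.
  - by rewrite ge_min le_max lexx.
have dv : d < v by exact: lt_trans dy yv.
have [|||u [du uv gu]] := @root_between R (fun s => g s - d) d v _ (ltW dv).
- exact: continuous_subc.
- by lra.
- by rewrite /g ffv; lra.
move/subr0_eq: gu => gu.
have {}du : d < u.
  by rewrite lt_neqAle du andbT; apply/eqP => E; move: gu; rewrite -E gd; lra.
have uz0 : u < z0 by exact: le_lt_trans uv vz0.
have [c [dc cu gc cL]] := horseshoe_cycle cg du uz0 gd gz0 gu n0.
have cin i : (i < n)%N -> d < iter i g c < z0.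
  elim: i => [_|i IH iN] /=; first by lra.
  apply/andP; split; first by apply: lt_trans dc _; apply: (cL i.+1).
  by apply: gz; apply: IH; exact: ltnW.
exists c; split; [by rewrite double_gt0 | by rewrite -gE |].
move=> i /andP[i0 iN].
have ih : (i./2 < n)%N.
  rewrite -ltn_double (leq_ltn_trans _ iN) //.
  by rewrite -[X in (_ <= X)%N]odd_double_half leq_addl.
rewrite -(odd_double_half i); case oi: (odd i);
  rewrite ?add1n ?add0n ?iterS -gE.
  by have := fgtz _ (cin _ ih); lra.
have := cL i./2; rewrite ih andbT half_gt0.
by case: i i0 oi {iN ih} => [|[|i]] // _ _ /(_ isT); lra.
Qed.

(** * Forcing in the Sharkovsky order *)

Lemma odd_period_larger (R : realType) (f : R -> R) p q x : continuous f ->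
  odd p -> odd q -> (1 < p)%N -> (p <= q)%N -> periodic_point f p x ->
  exists y, periodic_point f q y.
Proof.
move=> cf op oq p1 pq pp.
suff H k : exists y, periodic_point f (p + k.*2) y.
  have := H (q - p)./2; rewrite even_halfK ?oddB ?op ?oq // subnKC //.
elim: k => [|k [y py]]; first by exists x; rewrite addn0.
rewrite doubleS !addnS; apply: odd_period_next py => //.
  by rewrite oddD odd_double op.
by rewrite (leq_trans p1) ?leq_addr.
Qed.

Lemma period_of_iter_even (T : Type) (f : T -> T) k r x :
  periodic_point (iter (2 ^ k) f) r.*2 x -> periodic_point f (2 ^ k * r.*2) x.
Proof.
move=> px; have [i [_ ik]] := periodic_iter_pow2 px; case: ik => [-> //|].
by rewrite odd_double.
Qed.

Lemma even_row_period (R : realType) (f : R -> R) k p r x :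
  continuous f -> odd p -> (1 < p)%N -> (0 < r)%N ->
  periodic_point f (2 ^ k * p) x ->
  exists y, periodic_point f (2 ^ k * r.*2) y.
Proof.
move=> cf op p1 r0 px; have pp := periodic_iter_mul (ltnW p1) px.
have [y py] := odd_period_even (continuous_iter cf) op p1 r0 pp.
by exists y; exact: period_of_iter_even.
Qed.

(** A point of period q for f^(2^k) may have period 2^i q with i < k for f. In
that case f^(2^i) has the odd period q, hence every even period, in particular
2^(k-i) q. *)
Lemma same_row_period (R : realType) (f : R -> R) k p q x : continuous f ->
  odd p -> odd q -> (1 < p)%N -> (p <= q)%N -> periodic_point f (2 ^ k * p) x ->
  exists y, periodic_point f (2 ^ k * q) y.
Proof.
move=> cf op oq p1 pq px; have pp := periodic_iter_mul (ltnW p1) px.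
have [y qy] := odd_period_larger (continuous_iter cf) op oq p1 pq pp.
have [i [ik _ py]] := periodic_iter_pow2 qy.
have [<-|ki] := eqVneq i k; first by exists y.
have {ki}ik : (i < k)%N by rewrite ltn_neqAle ki.
have r0 : (0 < 2 ^ (k - i).-1 * q)%N
    by rewrite muln_gt0 expn_gt0 (odd_gt0 oq).
have [w pw] := even_row_period cf oq (leq_trans p1 pq) r0 py.
exists w; move: pw; rewrite -mul2n !mulnA -expnSr -expnD.
by have -> : (i.+1 + (k - i).-1 = k)%N by lia.
Qed.

(** For l > 0, f^(2^(l-1)) has a point of period 2s > 2, hence one of
period 2. *)
Lemma pow2_period (R : realType) (f : R -> R) l s x : continuous f ->
  (1 < s)%N -> periodic_point f (2 ^ l * s) x ->
  exists y, periodic_point f (2 ^ l) y.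
Proof.
move=> cf s1; case: l => [|l] px; first exact: fixed_point_of_period cf px.
have {}px : periodic_point (iter (2 ^ l) f) s.*2 x.
  by apply: periodic_iter_mul; [lia | rewrite -mul2n mulnA -expnSr].
have s2 : (2 < s.*2)%N by lia.
have [y py] := period_2_of_gt2 (continuous_iter cf) s2 px.
by exists y; rewrite expnSr; exact: (@period_of_iter_even _ _ l 1).
Qed.

Lemma sharkovsky_forcing (R : realType) (f : R -> R) m n x : continuous f ->
  sharkovsky_lt m n -> periodic_point f m x -> exists y, periodic_point f n y.
Proof.
move=> cf mn; elim: mn x => {m n}.
- by move=> k p q op oq p1 /ltnW pq x; exact: same_row_period.
- move=> k l p q op oq p1 q1 kl x px.
  have r0 : (0 < 2 ^ (l - k).-1 * q)%N
    by rewrite muln_gt0 expn_gt0 (odd_gt0 oq).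
  have [w pw] := even_row_period cf op p1 r0 px.
  exists w; move: pw; rewrite -mul2n !mulnA -expnSr -expnD.
  by have -> : (k.+1 + (l - k).-1 = l)%N by lia.
- move=> k l p op p1 x px; have [kl|lk] := ltnP k l.
    have r0 : (0 < 2 ^ (l - k).-1)%N by rewrite expn_gt0.
    have [w pw] := even_row_period cf op p1 r0 px.
    exists w; move: pw; rewrite -mul2n mulnA -expnSr -expnD.
    by have -> : (k.+1 + (l - k).-1 = l)%N by lia.
  apply: (@pow2_period _ _ _ (2 ^ (k - l) * p) x) => //.
    by rewrite (leq_trans p1) // leq_pmull ?expn_gt0.
  by rewrite mulnA -expnD subnKC.
- move=> k l lk x px; apply: (@pow2_period _ _ _ (2 ^ (k - l)) x) => //.
    by rewrite -{1}(expn0 2) ltn_exp2l // subn_gt0.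
  by rewrite -expnD subnKC // ltnW.
Qed.

(** Clamping the argument to [a, b] extends f to the line without creating new
cycles: every periodic point of the extension is a value of f on [a, b], and
there clamping is the identity. *)
Lemma sharkovsky_forcing_segment (R : realType) (a b : R) (f : R -> R) m n :
  a <= b -> {within `[a, b], continuous f} -> set_fun `[a, b] `[a, b] f ->
  sharkovsky_lt m n ->
  has_period `[a, b] f m -> has_period `[a, b] f n.
Proof.
move=> ab cf fab mn [x xab px].
pose clamp (t : R) := Order.max a (Order.min b t).
have clamp_in t : clamp t \in `[a, b].
  by rewrite in_itv /= /clamp le_max lexx /= ge_max ab ge_min lexx.
have clampK t : t \in `[a, b] -> clamp t = t.
  by rewrite in_itv /= => /andP[ta tb]; rewrite /clamp min_r // max_r.
have cc : continuous clamp.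
  move=> t; apply: (@continuous_max _ _ (fun=> a) (Order.min b)).
    exact: cvg_cst.
  apply: (@continuous_min _ _ (fun=> b) id); first exact: cvg_cst.
  exact: cvg_id.
have cg : continuous (f \o clamp).
  move=> t.
  apply: (@cvg_comp _ _ _ clamp f (nbhs t) (within `[a, b] (nbhs (clamp t)))).
    move=> B HB.
    have : nbhs t [set s | `[a, b]%classic (clamp s) -> B (clamp s)].
      exact: cc t _ HB.
    by apply: (@filterS _ (nbhs t)) => s; apply; exact: clamp_in.
  have tab : `[a, b]%classic (clamp t) by exact: clamp_in.
  rewrite (nbhs_subspace_in tab); exact: cf.
have gE j t : t \in `[a, b] ->
    iter j f t \in `[a, b] /\ iter j (f \o clamp) t = iter j f t.
  move=> tab; elim: j => [//|j [IH1 IH2]].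
  rewrite !iterS /= IH2 clampK //; split=> //.
  exact: fab.
have [|y [n0 gy ny]] := @sharkovsky_forcing _ (f \o clamp) m n x cg mn.
  case: px => m0 fx nx; split=> //; first by rewrite (gE _ _ xab).2.
  by move=> i im; rewrite (gE _ _ xab).2; exact: nx.
have yab : y \in `[a, b].
  by rewrite -gy -(prednK n0) /=; exact/fab/clamp_in.
exists y => //; split=> //; first by rewrite -(gE _ _ yab).2.
by move=> i im; rewrite -(gE _ _ yab).2; exact: ny.
Qed.

(** * Totality of the order *)

Lemma sharkovsky_total m n : (0 < m)%N -> (0 < n)%N -> m <> n ->
  sharkovsky_lt m n \/ sharkovsky_lt n m.
Proof.
move=> /odd_decomp[k [p [op ->]]] /odd_decomp[l [q [oq ->]]] mn.
have [p1|p1] := leqP p 1.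
  have {p1}p1 : p = 1%N by case: p op p1 {mn} => [|[]].
  rewrite p1 {p p1 op} in mn *.
  have [q1|q1] := leqP q 1.
    have {q1}q1 : q = 1%N by case: q oq q1 {mn} => [|[]].
    rewrite q1 {q q1 oq} !muln1 in mn *; have [kl|lk|kl] := ltngtP k l.
    - by right; constructor.
    - by left; constructor.
    - by case: mn; rewrite kl.
  by right; rewrite muln1; constructor.
have [q1|q1] := leqP q 1.
  have {q1}-> : q = 1%N by case: q oq q1 {mn} => [|[]].
  by left; rewrite muln1; constructor.
have [kl|lk|kl] := ltngtP k l.
- by left; constructor.
- by right; constructor.
rewrite kl in mn *; have [pq|qp|pq] := ltngtP p q.
- by left; constructor.
- by right; constructor.
- by case: mn; rewrite pq.
Qed.

Lemma sharkovsky_lt3 n : (0 < n)%N -> n <> 3%N -> sharkovsky_lt 3 n.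
Proof.
move=> /odd_decomp[l [q [oq ->]]] n3; rewrite -[3%N]/(2 ^ 0 * 3)%N.
have [q1|q1] := leqP q 1.
  have -> : q = 1%N by case: q oq q1 {n3} => [|[]].
  by rewrite muln1; constructor.
case: l n3 => [|l] n3; last by constructor.
constructor => //; rewrite mul1n in n3.
by case: q oq q1 n3 => [|[|[|[]]]].
Qed.

(** * Truncated tent maps *)

Section Tent.
Context {R : realType}.
Implicit Types (x h : R) (m n : nat).

Definition tent x : R := Num.min (2 * x) (2 - 2 * x).

Definition truncated_tent h x : R := Num.min h (tent x).

Lemma tent_in x : x \in `[0, 1] -> tent x \in `[0, 1].
Proof. by rewrite !in_itv /= /tent minEle; case: ifP; lra. Qed.

Lemma truncated_tent_in h x : h \in `[0, 1] -> x \in `[0, 1] ->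
  truncated_tent h x \in `[0, 1].
Proof.
by move=> h01 /tent_in; move: h01; rewrite /truncated_tent minEle; case: ifP.
Qed.

Lemma continuous_tent : continuous tent.
Proof.
have c2 : continuous (fun x : R => 2 * x).
  exact: mulrl_continuous.
have c22 : continuous (fun x : R => 2 - 2 * x).
  by move=> x; apply: cvgB; [exact: cvg_cst | exact: c2].
move=> x; apply: (@continuous_min _ _ (fun x => 2 * x) (fun x => 2 - 2 * x)).
  exact: c2.
exact: c22.
Qed.

Lemma continuous_truncated_tent h : continuous (truncated_tent h).
Proof.
move=> x; apply: (@continuous_min _ _ (fun=> h) tent); first exact: cvg_cst.
exact: continuous_tent.
Qed.

Lemma tent_has_period n : (0 < n)%N -> has_period `[0, 1] tent n.
Proof.
have p3 : has_period `[0, 1] tent 3.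
  exists (2 / 7); first by rewrite /= in_itv /=; lra.
  have t2 : tent (2 / 7) = 4 / 7 by rewrite /tent minEle; case: ifP; lra.
  have t4 : tent (4 / 7) = 6 / 7 by rewrite /tent minEle; case: ifP; lra.
  have t6 : tent (6 / 7) = 2 / 7 by rewrite /tent minEle; case: ifP; lra.
  split=> //=; first by rewrite t2 t4 t6.
  by case=> [|[|[|]]] // _ /=; rewrite !(t2, t4); lra.
have [->//|/eqP n3 n0] := eqVneq n 3%N.
apply: sharkovsky_forcing_segment p3 => //.
- exact/continuous_subspaceT/continuous_tent.
- by move=> x; exact: tent_in.
- exact: sharkovsky_lt3.
Qed.

(** T^n is piecewise affine; the slopes are 2^n up to sign, the constant terms
integers. *)
Lemma tent_iter_affine n x : exists s : bool,
  iter n tent x - (-1) ^+ s * 2 ^+ n * x \is a Num.int.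
Proof.
elim: n => [|n [s IH]]; first by exists false; rewrite !mul1r subrr.
have i2 : (2 : R) \is a Num.int by rewrite (intr_int _ 2).
rewrite iterS; set t := iter n tent x in IH *.
rewrite /tent minEle; case: ifP => _.
  exists s; have -> : 2 * t - (-1) ^+ s * 2 ^+ n.+1 * x =
      2 * (t - (-1) ^+ s * 2 ^+ n * x) by rewrite exprS; ring.
  by rewrite rpredM.
exists (~~ s); have -> : 2 - 2 * t - (-1) ^+ (~~ s) * 2 ^+ n.+1 * x =
    2 - 2 * (t - (-1) ^+ s * 2 ^+ n * x) by rewrite exprS signrN; ring.
by rewrite rpredB // rpredM.
Qed.

(** If x = s 2^n x + c with s = 1 or s = -1, multiplying x (1 - s 2^n) = c by
1 + s 2^n removes the dependence on s. *)
Lemma tent_periodic_nat n x : 0 <= x -> iter n tent x = x ->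
  exists j : nat, x * (4 ^+ n - 1) = j%:R.
Proof.
move=> x0 fx; apply/natrP.
rewrite natrEint mulr_ge0 ?subr_ge0 ?exprn_ege1 //; last first.
  by rewrite (ler_nat _ 1 4).
rewrite andbT; have [s] := tent_iter_affine n x; rewrite fx => ix.
have -> : x * (4 ^+ n - 1) =
    - (x - (-1) ^+ s * 2 ^+ n * x) * (1 + (-1) ^+ s * 2 ^+ n).
  have -> : (4 : R) ^+ n = 2 ^+ n * 2 ^+ n by rewrite -exprMn -natrM.
  have ss : (-1) ^+ s * (-1) ^+ s = 1 :> R by rewrite -expr2 sqrr_sign.
  transitivity (x * ((-1) ^+ s * (-1) ^+ s * (2 ^+ n * 2 ^+ n) - 1));
    last by ring.
  by rewrite ss mul1r.
rewrite rpredM ?rpredN // rpredD ?rpred1 // rpredM ?rpredX ?rpredN ?rpred1 //.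
by rewrite (intr_int _ 2).
Qed.

Definition cycle_top n x :=
  [/\ x \in `[0, 1], periodic_point tent n x & forall j, iter j tent x <= x].

Lemma cycle_top_of_periodic n x :
  x \in `[0, 1] -> periodic_point tent n x ->
  exists k, cycle_top n (iter k tent x).
Proof.
move=> x01 px; have [n0 fx _] := px.
have [k kP] := orbit_min (fun t : R => - t) n0 fx.
exists k; split; last 2 first.
- exact: periodic_orbit.
- by move=> j; rewrite -iterD -lerN2; exact: kP.
by elim: k {kP} => //= k; exact: tent_in.
Qed.

(** Tops of n-cycles are natural multiples of 1/(4^n - 1), so the least one is
found by minimizing a natural number. *)
Lemma least_cycle_top n : (0 < n)%N ->
  exists2 h, cycle_top n h & forall x, cycle_top n x -> h <= x.
Proof.
move=> n0; have [x x01 px] := tent_has_period n0.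
have N0 : 0 < 4 ^+ n - 1 :> R.
  by rewrite subr_gt0 exprn_egt1 ?lt0n_neq0 // (ltr_nat _ 1 4).
have topj y : cycle_top n y -> exists j : nat, y * (4 ^+ n - 1) = j%:R.
  case; rewrite in_itv /= => /andP[y0 _] [_ fy _] _.
  exact: tent_periodic_nat.
have [k kt] := cycle_top_of_periodic x01 px.
have ex : exists j : nat, `[< cycle_top n (j%:R / (4 ^+ n - 1)) >].
  have [j jE] := topj _ kt; exists j; apply/asboolP.
  by rewrite -jE mulfK // lt0r_neq0.
case: (ex_minnP ex) => j /asboolP jt jP.
exists (j%:R / (4 ^+ n - 1)) => // y yt.
have [i iE] := topj _ yt.
rewrite ler_pdivrMr // iE ler_nat; apply: jP; apply/asboolP.
by rewrite -iE mulfK // lt0r_neq0.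
Qed.

Lemma truncated_tent_periodic n h : cycle_top n h ->
  periodic_point (truncated_tent h) n h.
Proof.
move=> [_ [n0 fh nh] hP].
have E j : iter j (truncated_tent h) h = iter j tent h.
  elim: j => //= j ->; rewrite /truncated_tent min_r //; exact: (hP j.+1).
by split=> //; [rewrite E | move=> i ni; rewrite E; exact: nh].
Qed.

(** Periodic points of min(h, T) are values of this map, hence at most h; an
n-cycle avoids h, whose period is m. So the n-cycle lies strictly below h, where
min(h, T) and T agree along it. *)
Lemma truncated_tent_cycle_below m n h : m <> n ->
  periodic_point (truncated_tent h) m h ->
  has_period `[0, 1] (truncated_tent h) n ->
  exists2 t, cycle_top n t & t < h.
Proof.
move=> mn ph [y y01 py]; have [n0 fy ny] := py.
have below j : iter j (truncated_tent h) y < h.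
  rewrite lt_neqAle; apply/andP; split.
    apply/eqP => E; apply: mn; apply: periodic_unique ph _.
    by have := periodic_orbit j py; rewrite E.
  by rewrite -fy -iterD addnC -(prednK n0) addSn iterS ge_min lexx.
have E j : iter j (truncated_tent h) y = iter j tent y.
  elim: j => //= j IH; have := below j.+1; rewrite /= IH /truncated_tent minEle.
  by case: ifP; rewrite ?ltxx.
have pt : periodic_point tent n y.
  by split=> //; [rewrite -E | move=> i ni; rewrite -E; exact: ny].
have [k kt] := cycle_top_of_periodic y01 pt.
by exists (iter k tent y); rewrite // -E.
Qed.

(** The map min(h, T) has an m-cycle, so it has an n-cycle, which lies below h. *)
Lemma lower_cycle_top h m n :
  cycle_top m h -> sharkovsky_lt m n -> m <> n ->
  exists2 t, cycle_top n t & t < h.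
Proof.
move=> ht lmn mn; have [h01 _ _] := ht; have ph := truncated_tent_periodic ht.
apply: (truncated_tent_cycle_below mn ph).
apply: sharkovsky_forcing_segment lmn _ => //.
- exact/continuous_subspaceT/continuous_truncated_tent.
- by move=> x; exact: truncated_tent_in.
- by exists h.
Qed.

(** With h and g the least tops of cycles of lengths m and n, forcing applied to
min(g, T) gives h < g, whereas an n-cycle of min(h, T) would give g < h. *)
Lemma truncated_tent_realizes m n :
  (0 < m)%N -> (0 < n)%N -> m <> n -> sharkovsky_lt n m ->
  exists h, [/\ h \in `[0, 1], has_period `[0, 1] (truncated_tent h) m &
    ~ has_period `[0, 1] (truncated_tent h) n].
Proof.
move=> m0 n0 mn lnm.
have [h ht hP] := least_cycle_top m0.
have [g gt gP] := least_cycle_top n0.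
have [h01 _ _] := ht; have ph := truncated_tent_periodic ht.
exists h; split=> //; first by exists h.
move=> /(truncated_tent_cycle_below mn ph)[t /gP gt' th].
have [s /hP hs sg] := lower_cycle_top gt lnm (fun e => mn (esym e)).
by have := lt_trans sg (le_lt_trans gt' th); rewrite ltNge hs.
Qed.

End Tent.

(** * Transport to an arbitrary segment *)

Lemma periodic_conj (T U : Type) (g : T -> T) (phi : T -> U) (psi : U -> T)
    m x :
  cancel phi psi ->
  periodic_point (phi \o g \o psi) m (phi x) <-> periodic_point g m x.
Proof.
move=> phiK.
have E j : iter j (phi \o g \o psi) (phi x) = phi (iter j g x).
  by elim: j => //= j ->; rewrite phiK.
have inj := can_inj phiK.
split=> -[m0 gx nx]; split=> //.
- by apply: inj; rewrite -E.
- by move=> i /nx; rewrite E => H e; apply: H; rewrite e.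
- by rewrite E gx.
- by move=> i /nx H; rewrite E => /inj.
Qed.

Lemma transport_to_segment (R : realType) (a b : R) (g : R -> R) : a < b ->
  continuous g -> (forall x, x \in `[0, 1] -> g x \in `[0, 1]) ->
  exists f : R -> R, [/\ {within `[a, b], continuous f},
    set_fun `[a, b] `[a, b] f &
    forall n, has_period `[a, b] f n <-> has_period `[0, 1] g n].
Proof.
move=> ab cg g01; have ab0 : 0 < b - a by rewrite subr_gt0.
pose phi (x : R) := (b - a) * x + a; pose psi (y : R) := (b - a)^-1 * (y - a).
have phiK : cancel phi psi.
  by move=> x; rewrite /phi /psi addrK mulKf // gt_eqF.
have psiK : cancel psi phi.
  by move=> x; rewrite /phi /psi mulVKf ?gt_eqF // subrK.
have phi_in x : x \in `[0, 1] -> phi x \in `[a, b].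
  rewrite !in_itv /= /phi; nra.
have psi_in y : y \in `[a, b] -> psi y \in `[0, 1].
  by rewrite !in_itv /= /psi mulrC ler_pdivrMr // ler_pdivlMr //; lra.
exists (phi \o g \o psi); split.
- have cpsi : continuous psi.
    move=> y.
    apply: (@continuous_comp _ _ _ (fun y => y - a) ( *%R (b - a)^-1)).
      by apply: continuous_subc => ?; exact: cvg_id.
    exact: mulrl_continuous.
  have cphi : continuous phi.
    move=> x; apply: (@continuousD _ _ _ ( *%R (b - a)) (fun=> a)).
      exact: mulrl_continuous.
    exact: cvg_cst.
  apply: continuous_subspaceT => y; apply: continuous_comp; first exact: cpsi.
  by apply: continuous_comp; [exact: cg | exact: cphi].
- by move=> y /psi_in /g01 /phi_in.
move=> n; split=> -[y yI py].
  exists (psi y); first exact: psi_in.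
  by apply/(periodic_conj _ _ _ phiK); rewrite psiK.
by exists (phi y); [exact: phi_in | apply/(periodic_conj _ _ _ phiK)].
Qed.

Unset Implicit Arguments.

Theorem theorem6 (R : realType) (a b : R) (ab : a < b) (m n : nat)
    (m_gt0 : (0 < m)%N) (n_gt0 : (0 < n)%N) (mn : m <> n) :
  (forall f : R -> R,
     {within `[a, b], continuous f} ->
     set_fun `[a, b] `[a, b] f ->
     has_period `[a, b] f m -> has_period `[a, b] f n)
  <-> sharkovsky_lt m n.
Proof.
split=> [forced | lmn f cf fab].
  have [//|lnm] := sharkovsky_total m_gt0 n_gt0 mn.
  have [h [h01 hm nhn]] := truncated_tent_realizes (R := R) m_gt0 n_gt0 mn lnm.
  have [f [cf fab fE]] := transport_to_segment ab
    (continuous_truncated_tent (h := h))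
    (fun x => truncated_tent_in h01).
  by case: nhn; apply/fE/forced => //; apply/fE.
exact: sharkovsky_forcing_segment (ltW ab) cf fab lmn.
Qed.
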